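(* Let $m\ge2$, let $p_1,\dots,p_m>0$ with $\sum_i p_i=1$ be linearly independent over $\mathbb{Q}$, and let $\gamma\in\mathbb{R}$. For the $\gamma$-quota method, with $N$ uniformly distributed on $\{1,\dots,N_0\}$, as $N_0\to\infty$, for each $i$, $$\Delta_i\xrightarrow{\mathrm d}Y_i:=\gamma\Bigl(p_i-\frac1m\Bigr)+\widetilde U_0+\frac1m\sum_{k=1}^{m-2}\widetilde U_k,$$ where $\widetilde U_0,\dots,\widetilde U_{m-2}$ are independent and uniform on $(-\frac12,\frac12)$.
   Context: There are $m$ parties; party $i$ has proportion $p_i>0$ of the votes. $N$ (the house size) seats are distributed, party $i$ gets $s_i=s_i(N)$ seats with $\sum_i s_i=N$, and the seat excess is $\Delta_i=s_i-Np_i$. For real $\alpha,x$, the $\alpha$-rounding $[x]_\alpha$ is an integer $n$ with $x-\alpha\le n\le x-\alpha+1$ (if $x-\alpha\in\mathbb{Z}$, both $x-\alpha$ and $x-\alpha+1$ are accepted values). The $\gamma$-quota method (for $N+\gamma>0$): $s_i=[(N+\gamma)p_i]_\alpha$ for all $i$, where the real number $\alpha$ (and the choices of rounding in case of ties) are such that $\sum_i s_i=N$. Ties are resolved at random. Finitely many $N$ with $N+\gamma\le0$ are irrelevant for the limit and may be ignored. $\xrightarrow{\mathrm d}$ denotes convergence in distribution. *)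

(* Defs.v *)
From HB Require Import structures.
From mathcomp Require Import all_boot all_order all_algebra finmap.
From mathcomp Require Import all_classical all_reals all_analysis.
From mathcomp Require Import measurable_realfun.

Set Implicit Arguments.
Unset Strict Implicit.
Unset Printing Implicit Defensive.

Import Order.TTheory GRing.Theory Num.Theory.
Import numFieldNormedType.Exports.

Local Open Scope classical_set_scope.
Local Open Scope ring_scope.

(* [int] carries its discrete sigma-algebra, exactly as the library does for
   [nat]. *)
HB.instance Definition _ := isPointed.Build int 0.
HB.instance Definition _ := @isMeasurable.Build default_measure_display
  int discrete_measurable discrete_measurable0
  discrete_measurableC discrete_measurableU.

Definition Q_linearly_independent (R : realType) (m : nat) (p : 'I_m -> R) :
    Prop :=
  forall c : 'I_m -> rat, \sum_(i < m) ratr (c i) * p i = 0 ->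
    forall i, c i = 0.

(* A relation: both values of [n] are accepted when [x - alpha] is an
   integer. *)
Definition alpha_rounding (R : realType) (alpha x : R) (n : int) : Prop :=
  x - alpha <= n%:~R <= x - alpha + 1.

(* [s] is a possible seat vector, for some way of resolving ties. *)
Definition quota_allocation (R : realType) (m : nat) (gamma : R)
    (p : 'I_m -> R) (N : nat) (s : 'I_m -> int) : Prop :=
  \sum_(i < m) s i = N%:Z /\
  exists alpha : R, forall i, alpha_rounding alpha ((N%:R + gamma) * p i) (s i).

Section random_variables.
Context (R : realType) (d : measure_display) (T : measurableType d).
Context (P : probability T R).

Definition uniform_1_to (n : nat) (N : {RV P >-> nat}) : Prop :=
  forall k : nat, (1 <= k <= n)%N -> P (N @^-1` [set k]) = (n%:R^-1)%:E.

Lemma half_interval : - (1 / 2) < 1 / 2 :> R.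
Proof. by rewrite ltrNl (@lt_trans _ _ 0)// ?oppr_lt0 divr_gt0. Qed.

Definition uniform_half (U : {RV P >-> R}) : Prop :=
  forall A : set R, measurable A ->
    distribution P U A = uniform_prob half_interval A.

Definition mutually_independent (I : choiceType) (D : set I)
    (X : I -> {RV P >-> R}) : Prop :=
  forall J : {fset I}, [set` J] `<=` D ->
  forall A : I -> set R, (forall i, i \in J -> measurable (A i)) ->
    P (\bigcap_(i in [set` J]) (X i @^-1` A i)) =
    (\prod_(i <- J) P (X i @^-1` A i))%E.

Definition seat_excess_fun (q : R) (N : {RV P >-> nat}) (S : {RV P >-> int}) :
    T -> R := fun w => (S w)%:~R - (N w)%:R * q.

Lemma measurable_seat_excess q N S :
  measurable_fun setT (seat_excess_fun q N S).
Proof.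
apply: measurable_funB.
  by apply: (@measurableT_comp _ _ _ _ _ _ (fun z : int => z%:~R : R)).
apply: measurable_funM => //.
by apply: (@measurableT_comp _ _ _ _ _ _ (fun z : nat => z%:R : R)).
Qed.

HB.instance Definition _ q N S := isMeasurableFun.Build _ _ _ _
  (seat_excess_fun q N S) (measurable_seat_excess q N S).

Definition seat_excess (q : R) (N : {RV P >-> nat}) (S : {RV P >-> int}) :
  {RV P >-> R} := seat_excess_fun q N S.

Definition limit_excess_fun (m : nat) (gamma q : R) (U : nat -> {RV P >-> R}) :
    T -> R :=
  fun w => gamma * (q - 1 / m%:R) + U 0%N w +
           1 / m%:R * \sum_(1 <= k < m.-1) U k w.

Lemma measurable_limit_excess m gamma q U :
  measurable_fun setT (limit_excess_fun m gamma q U).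
Proof.
apply: measurable_funD; first exact: measurable_funD.
by apply: measurable_funM => //; apply: measurable_sum => k.
Qed.

HB.instance Definition _ m gamma q U := isMeasurableFun.Build _ _ _ _
  (limit_excess_fun m gamma q U) (measurable_limit_excess m gamma q U).

Definition limit_excess (m : nat) (gamma q : R) (U : nat -> {RV P >-> R}) :
  {RV P >-> R} := limit_excess_fun m gamma q U.

End random_variables.

(* The variables [X n] may live on different probability spaces. *)
Definition cvg_in_distribution (R : realType)
    (d : nat -> measure_display) (T : forall n, measurableType (d n))
    (P : forall n, probability (T n) R) (X : forall n, {RV (P n) >-> R})
    (d' : measure_display) (T' : measurableType d') (Q : probability T' R)
    (Y : {RV Q >-> R}) : Prop :=
  forall x : R, {for x, continuous (cdf Y)} ->
    cdf (X n) x @[n --> \oo] --> cdf Y x.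

(* Main.v *)
(** With [x_j = (N + gamma) p_j] and [A = gamma (p_i - 1/m)], the quota rule gives
    [Delta_i = A + (1/m) \sum_(j <> i) D_j], where [D_j] lies in [(-1, 1)] and is
    congruent to [x_j - x_i] modulo 1 (for all large [N], by linear independence,
    no [x_j - x_i] is an integer).  Fixing some [k <> i], this confines [Delta_i] to
    an interval [(b, b + 1)], where [b] is
    [A - (m-1)/m + (1/m) \sum_(j <> i, k) frac (x_j - x_i)].
    As [Delta_i] is congruent to [- N p_i] modulo 1, the event [Delta_i <= x] is
    exactly [frac (N p_i + x) + b < x]: an affine condition on [m - 1] fractional
    parts whose frequencies and 1 are independent over the rationals.  By Weyl
    equidistribution these behave like independent uniform variables on [(0, 1)],
    and the same affine form of [U_k + 1/2] is the limit variable.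

    Equidistribution is obtained from the weights
    [\prod_j F_K (z_j - l_j / K)], [F_K] a normalised Fejer kernel and [l] a point of
    the grid of mesh [1/K]: they are nonnegative, sum to 1 over the grid, concentrate
    near [z], and along the orbit each has asymptotic mean [K^-d]. *)
Require Import Defs.
From HB Require Import structures.
From mathcomp Require Import all_boot all_order all_algebra finmap.
From mathcomp Require Import all_classical all_reals all_analysis.
From mathcomp Require Import ring lra zify.

Set Implicit Arguments.
Unset Strict Implicit.
Unset Printing Implicit Defensive.

Import Order.TTheory GRing.Theory Num.Theory.
Import numFieldNormedType.Exports.

Local Open Scope classical_set_scope.
Local Open Scope ring_scope.

(** * Fejer kernels *)

Section trigonometric_sums.
Context {R : realType}.
Implicit Types (x y c : R) (n K : nat).

Lemma mulr_cos_cos x y : cos x * cos y = (cos (x + y) + cos (x - y)) / 2.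
Proof. by rewrite cosD cosB; field. Qed.

(** Each [2 sin y cos a] is a difference of sines at [a + y] and [a - y], so the sum telescopes. *)
Lemma sin_sum_cos y c n :
  2 * sin y * \sum_(k < n) cos (2 * y * k%:R + c) =
  sin (2 * y * n%:R - y + c) - sin (c - y).
Proof.
elim: n => [|n IH].
  by rewrite big_ord0 !mulr0 sub0r (addrC (- y)) subrr.
rewrite big_ord_recr /= mulrDr IH.
have -> : 2 * y * n.+1%:R - y + c = (2 * y * n%:R + c) + y.
  by rewrite -natr1; ring.
have -> : 2 * y * n%:R - y + c = (2 * y * n%:R + c) - y by ring.
have key a : 2 * sin y * cos a = sin (a + y) - sin (a - y).
  by rewrite sinD sinB; ring.
by rewrite key; ring.
Qed.

(** The bound does not depend on [n]; it yields both the decay of the kernel away from the integers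
    and the vanishing of cosine means. *)
Lemma sin_sum_cos_le1 y c n :
  `|sin y * \sum_(k < n) cos (2 * y * k%:R + c)| <= 1.
Proof.
have := sin_sum_cos y c n; rewrite -mulrA; set S := sin y * _ => E.
have h1 := sin_max (2 * y * n%:R - y + c).
have h2 := sin_max (c - y).
move: E h1 h2; rewrite !ler_norml => E /andP[? ?] /andP[? ?].
by apply/andP; split; lra.
Qed.

Lemma sin_sum_sin_le1 y n :
  `|sin y * \sum_(k < n) sin (2 * y * k%:R)| <= 1.
Proof.
under eq_bigr do rewrite -cosBpihalf.
exact: sin_sum_cos_le1.
Qed.

Lemma sinDnpi x n : sin (x + pi *+ n) = (-1) ^+ n * sin x.
Proof. by rewrite alternatingn//; exact: sinDpi. Qed.

Lemma sqr_sinDzpi x (z : int) : sin (x + pi * z%:~R) ^+ 2 = sin x ^+ 2.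
Proof.
have nat_case (t : R) n : sin (t + pi *+ n) ^+ 2 = sin t ^+ 2.
  by rewrite sinDnpi exprMn sqrr_sign mul1r.
case: z => n.
  by rewrite -pmulrn mulr_natr nat_case.
rewrite NegzE mulrNz -pmulrn mulrN mulr_natr.
by rewrite -[in RHS](subrK (pi *+ n.+1) x) nat_case.
Qed.

Lemma cos_2piz (z : int) : cos (2 * pi * z%:~R) = 1 :> R.
Proof.
rewrite (_ : _ * _ = (pi * z%:~R) *+ 2); last by rewrite mulr2n; ring.
rewrite cos_mulr2n cos2sin2 -(add0r (pi * _)) sqr_sinDzpi sin0 expr0n/=.
by rewrite subr0 mulr2n; ring.
Qed.

Lemma sin_2piz (z : int) : sin (2 * pi * z%:~R) = 0 :> R.
Proof.
apply: cos1sin0; rewrite cos_2piz normr1 //.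
Qed.

Lemma sin_pi_neq0 x : (forall z : int, x != z%:~R) -> sin (pi * x) != 0.
Proof.
move=> xZ; rewrite -sqrf_eq0.
have -> : pi * x = pi * (x - (Num.floor x)%:~R) + pi * (Num.floor x)%:~R.
  by ring.
rewrite sqr_sinDzpi sqrf_eq0; apply/lt0r_neq0/sin_gt0_pi.
have f0 : 0 < x - (Num.floor x)%:~R.
  by rewrite subr_gt0 lt_neqAle eq_sym xZ/= floor_le.
have f1 : x - (Num.floor x)%:~R < 1.
  by have := floorD1_gt x; rewrite intrD; lra.
have p0 := @pi_gt0 R.
by rewrite mulr_gt0//= gtr_pMr.
Qed.

(** Only [t = |x - z|] matters; [sin (pi t)] is symmetric about [t = 1/2] and increases before
    it. *)
Lemma sqr_sin_pi_ge x (delta : R) (z : int) : 0 < delta <= 1 / 2 ->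
  delta <= `|x - z%:~R| <= 1 - delta ->
  sin (pi * delta) ^+ 2 <= sin (pi * x) ^+ 2.
Proof.
move=> /andP[d0 d1] /andP[h1 h2].
have p0 := @pi_gt0 R.
have -> : pi * x = pi * (x - z%:~R) + pi * z%:~R by ring.
rewrite sqr_sinDzpi.
have -> : sin (pi * (x - z%:~R)) ^+ 2 = sin (pi * `|x - z%:~R|) ^+ 2.
  case: (ger0P (x - z%:~R)) => // _.
  by rewrite mulrN sinN sqrrN.
move: h1 h2; set t := `|_| => h1 h2.
have sd0 : 0 <= sin (pi * delta).
  apply: sin_ge0_pi; apply/andP; split; first by rewrite mulr_ge0 // ltW.
  by rewrite ler_piMr//; lra.
rewrite lerXn2r ?nnegrE//.
  apply: sin_ge0_pi; apply/andP; split; first by rewrite mulr_ge0 //; lra.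
  by rewrite ler_piMr//; lra.
have mono (a b : R) : 0 <= a -> a <= b -> b <= 1 / 2 ->
    sin (pi * a) <= sin (pi * b).
  move=> a0 ab b1.
  have itv (u : R) : 0 <= u -> u <= 1 / 2 -> pi * u \in `[(- (pi / 2)), pi / 2].
    by move=> u0 u1; rewrite in_itv/=; apply/andP; split; nra.
  have ia := itv a a0 (le_trans ab b1).
  have ib := itv b (le_trans a0 ab) b1.
  rewrite leNgt (ltr_sin ib ia) -leNgt.
  by rewrite ler_pM2l.
have [t1|t1] := lerP t (1 / 2).
  by apply: mono => //; lra.
have -> : sin (pi * t) = sin (pi * (1 - t)).
  by rewrite mulrBr mulr1 sinB sinpi cospi; ring.
by apply: mono; lra.
Qed.

(** The squared modulus of the mean of [exp (2 pi i k x)] over [k < K]. With this scaling the peak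
    value is 1 and the [K] translates by multiples of [1/K] sum to 1. *)
Definition fejer K x : R :=
  ((\sum_(k < K) cos (2 * pi * x * k%:R)) ^+ 2 +
   (\sum_(k < K) sin (2 * pi * x * k%:R)) ^+ 2) / K%:R ^+ 2.

Lemma fejer_ge0 K x : 0 <= fejer K x.
Proof. by rewrite divr_ge0 ?addr_ge0 ?sqr_ge0. Qed.

(** The cosine sum and the sine sum each contribute at most 1 after multiplication by [sin (pi x)],
    whence the 2. *)
Lemma fejer_far K x : sin (pi * x) ^+ 2 * fejer K x <= 2 / K%:R ^+ 2.
Proof.
rewrite /fejer mulrA ler_wpM2r ?invr_ge0 ?sqr_ge0//.
rewrite mulrDr -!exprMn.
have := sin_sum_cos_le1 (pi * x) 0 K.
have := sin_sum_sin_le1 (pi * x) K.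
under eq_bigr do rewrite mulrA.
under [in X in _ -> X -> _]eq_bigr do rewrite mulrA addr0.
by rewrite !ler_norml => /andP[? ?] /andP[? ?]; nra.
Qed.

End trigonometric_sums.

(** * The kernel as a partition of unity on the grid *)

Section fejer_partition.
Context {R : realType}.
Implicit Types (x : R) (K : nat).

Lemma fejerE K x : fejer K x =
  (\sum_(a < K) \sum_(b < K) cos (2 * pi * (a%:R - b%:R) * x)) / K%:R ^+ 2.
Proof.
rewrite /fejer !expr2 !big_distrlr/= -big_split/=.
congr (_ / _); apply: eq_bigr => a _; rewrite -big_split/=.
apply: eq_bigr => b _; rewrite -cosB; congr cos; ring.
Qed.

Lemma ratio_not_int (a b : nat) K : (a < K)%N -> (b < K)%N -> a != b ->
  forall z : int, (a%:R - b%:R) / K%:R != z%:~R :> R.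
Proof.
move=> aK bK ab z; have K0 : (0 < K)%N by exact: leq_ltn_trans aK.
rewrite -(inj_eq (mulIf (lt0r_neq0 (_ : 0 < K%:R)))) ?ltr0n//.
rewrite mulfVK; last by rewrite pnatr_eq0 -lt0n.
rewrite !pmulrn -intrB -intrM eqr_int.
apply/eqP => E.
have [z0|z0] := eqVneq z 0; first by move: E ab; rewrite z0 mul0r; lia.
have : 1 <= `|z| by lia.
move: E; nia.
Qed.

(** In the expanded square, each of the [K] diagonal terms sums to [K] over the grid, while an
    off-diagonal term runs over full cycles and sums to 0. *)
Lemma sum_fejer K x : (0 < K)%N -> \sum_(l < K) fejer K (x - l%:R / K%:R) = 1.
Proof.
move=> K0; have KR : K%:R != 0 :> R by rewrite pnatr_eq0 -lt0n.
under eq_bigr do rewrite fejerE.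
rewrite -mulr_suml exchange_big/=.
rewrite (eq_bigr (fun=> K%:R)); last first.
  move=> a _; rewrite exchange_big/= (bigD1 a)//=.
  rewrite [X in X + _](eq_bigr (fun=> 1)); last first.
    by move=> l _; rewrite subrr mulr0 mul0r cos0.
  rewrite sumr_const card_ord big1 ?addr0// => b ba.
  set q : R := a%:R - b%:R.
  have q_notint : forall z : int, - (q / K%:R) != z%:~R.
    move=> z; rewrite eqr_oppLR -mulrNz; apply: ratio_not_int => //.
    by rewrite eq_sym.
  have := sin_sum_cos (pi * - (q / K%:R)) (2 * pi * q * x) K.
  set y := pi * - _.
  (* After [K] steps the phase has moved by an integer multiple of [2 pi], so the two ends of the
     telescoped sum cancel. *)
  have -> : 2 * y * K%:R - y + 2 * pi * q * x =
      2 * pi * q * x - y - 2 * pi * (a%:Z - b%:Z)%:~R.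
    by rewrite intrB -!pmulrn -/q /y; field.
  rewrite (sinB _ (2 * pi * _%:~R)) cos_2piz sin_2piz mulr1 mulr0 subr0 subrr.
  move=> /eqP; rewrite !mulf_eq0 pnatr_eq0/= (negbTE (sin_pi_neq0 q_notint))/=.
  move=> /eqP sum0; rewrite -[RHS]sum0; apply: eq_bigr => l _; congr cos.
  by rewrite /y; field.
by rewrite sumr_const card_ord -mulr_natr expr2; field.
Qed.

End fejer_partition.

(** * Equidistribution *)

Section weyl.
Context {R : realType}.
Implicit Types (f g : nat -> R) (x c : R).

Definition mean f (n : nat) : R := n%:R^-1 * \sum_(k < n) f k.+1.

Lemma cvg_invn : (n%:R^-1 : R) @[n --> \oo] --> 0.
Proof.
apply/gtr0_cvgV0; last exact: cvgr_idn.
by near=> n; rewrite ltr0n; near: n; exists 1%N.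
Unshelve. all: by end_near. Qed.

Lemma le_mean f g n : (forall k, f k <= g k) -> mean f n <= mean g n.
Proof.
by move=> fg; rewrite /mean ler_wpM2l ?invr_ge0//; exact: ler_sum.
Qed.

Lemma meanD f g n : mean (fun k => f k + g k) n = mean f n + mean g n.
Proof. by rewrite /mean big_split mulrDr. Qed.

Lemma meanM c f n : mean (fun k => c * f k) n = c * mean f n.
Proof. by rewrite /mean -mulr_sumr mulrCA. Qed.

Lemma mean_cst c n : (0 < n)%N -> mean (fun=> c) n = c.
Proof.
move=> n0; rewrite /mean sumr_const card_ord -[c *+ n]mulr_natr mulrCA.
by rewrite mulVf ?mulr1// pnatr_eq0 -lt0n.
Qed.

Lemma mean_sum (I : Type) (r : seq I) (P : pred I) (F : I -> nat -> R) n :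
  mean (fun k => \sum_(i <- r | P i) F i k) n =
  \sum_(i <- r | P i) mean (F i) n.
Proof. by rewrite /mean exchange_big/= mulr_sumr. Qed.

Lemma cvg_sum (I : Type) (r : seq I) (P : pred I) (F : I -> nat -> R)
    (l : I -> R) : (forall i, P i -> F i n @[n --> \oo] --> l i) ->
  (\sum_(i <- r | P i) F i n) @[n --> \oo] --> \sum_(i <- r | P i) l i.
Proof. by apply: cvg_big => //; exact: add_continuous. Qed.

Lemma mean_cos x c : (forall z : int, x != z%:~R) ->
  mean (fun k => cos (2 * pi * (k%:R * x + c))) n @[n --> \oo] --> 0.
Proof.
move=> xZ; have s0 := sin_pi_neq0 xZ.
have bnd n : `|mean (fun k => cos (2 * pi * (k%:R * x + c))) n| <=
    n%:R^-1 * `|sin (pi * x)|^-1.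
  rewrite /mean normrM [in X in X <= _]ger0_norm ?invr_ge0//.
  rewrite ler_wpM2l ?invr_ge0// -[leRHS]mul1r ler_pdivlMr ?normr_gt0//.
  rewrite -normrM mulrC.
  apply: le_trans (sin_sum_cos_le1 (pi * x) (2 * pi * (x + c)) n).
  rewrite le_eqVlt; apply/orP; left; apply/eqP; congr (`| _ * _|).
  apply: eq_bigr => k _; congr cos; rewrite -natr1; ring.
have lim0 : (n%:R^-1 * `|sin (pi * x)|^-1) @[n --> \oo] --> (0 : R).
  by rewrite -[0](mul0r `|sin (pi * x)|^-1); apply: cvgM cvg_invn (cvg_cst _).
apply: (@squeeze_cvgr _ _ _ _ (fun n => - (n%:R^-1 * `|sin (pi * x)|^-1))
  (fun n => n%:R^-1 * `|sin (pi * x)|^-1)) => //.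
  by near=> n; rewrite -ler_norml.
by rewrite -oppr0; exact: cvgN.
Unshelve. all: by end_near. Qed.

Variables (K : nat) (theta beta : nat -> R).
Hypothesis K0 : (0 < K)%N.

Definition fejer_weight r k : R :=
  \prod_(j < r) fejer K (k%:R * theta j + beta j).
Local Notation weight := fejer_weight.

Lemma fejer_weightS r k : weight r.+1 k = K%:R^-2 *
  \sum_(a < K) \sum_(b < K)
     cos (2 * pi * (k%:R * ((a%:R - b%:R) * theta r) +
                    (a%:R - b%:R) * beta r)) * weight r k.
Proof.
rewrite /fejer_weight big_ord_recr/= fejerE mulrA mulrC; congr (_ * _).
rewrite mulr_sumr; apply: eq_bigr => a _.
rewrite mulr_sumr; apply: eq_bigr => b _.
by rewrite mulrC; congr (cos _ * _); ring.
Qed.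

(** By induction on [r]: multiplying by a cosine of the last factor moves the frequency from [x] to
    [x + (a - b) theta r] and [x - (a - b) theta r], and the hypothesis is stable under such
    moves. *)
Lemma mean_cos_fejer_weight r x c :
  (forall (q : nat -> int) (z : int),
     x + \sum_(j < r) (q j)%:~R * theta j != z%:~R) ->
  mean (fun k => cos (2 * pi * (k%:R * x + c)) * weight r k) n
    @[n --> \oo] --> 0.
Proof.
elim: r x c => [|r IH] x c xZ.
  under eq_fun do under eq_fun do rewrite /fejer_weight big_ord0 mulr1.
  apply: mean_cos => z; have := xZ (fun=> 0) z.
  by rewrite big_ord0 addr0.
set d := fun a b : 'I_K => (a%:R - b%:R : R).
have -> : mean (fun k => cos (2 * pi * (k%:R * x + c)) * weight r.+1 k) =
    (fun n => K%:R^-2 * \sum_(a < K) \sum_(b < K) 2^-1 *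
     (mean (fun k => cos (2 * pi * (k%:R * (x + d a b * theta r) +
                             (c + d a b * beta r))) * weight r k) n +
      mean (fun k => cos (2 * pi * (k%:R * (x - d a b * theta r) +
                             (c - d a b * beta r))) * weight r k) n)).
  apply/funext => n; under eq_bigr do under eq_bigr do rewrite -meanD -meanM.
  under eq_bigr do rewrite -mean_sum.
  rewrite -mean_sum -meanM /mean; congr (_ * _); apply: eq_bigr => k _.
  rewrite fejer_weightS mulrCA; congr (_ * _); rewrite mulr_sumr.
  apply: eq_bigr => a _; rewrite mulr_sumr; apply: eq_bigr => b _.
  rewrite [LHS]mulrA mulr_cos_cos -mulrDl [RHS]mulrA [2^-1 * _]mulrC.
  by congr ((cos _ + cos _) / _ * _); rewrite /d; ring.
rewrite [X in _ --> X](_ : 0 =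
    K%:R^-2 * \sum_(a < K) \sum_(b < K) 2^-1 * (0 + 0)); last first.
  by rewrite big1 ?mulr0// => a _; rewrite big1// => b _; rewrite addr0 mulr0.
apply: cvgM (cvg_cst _) _; apply: cvg_sum => a _; apply: cvg_sum => b _.
apply: cvgM (cvg_cst _) _; apply: cvgD; apply: IH => q z; apply/eqP => E.
  (* A relation at the moved frequency is one at [x] with coefficient [a - b] on [theta r]. *)
  have /eqP := xZ (fun j => if j == r then a%:Z - b%:Z else q j) z; apply.
  rewrite big_ord_recr/= eqxx -E -addrA; congr (_ + _); rewrite addrC.
  congr (_ + _); first by rewrite intrB -!pmulrn.
  by apply: eq_bigr => j _; rewrite ltn_eqF.
have /eqP := xZ (fun j => if j == r then b%:Z - a%:Z else q j) z; apply.
rewrite big_ord_recr/= eqxx -E -addrA; congr (_ + _); rewrite addrC.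
congr (_ + _); first by rewrite intrB -!pmulrn /d; ring.
by apply: eq_bigr => j _; rewrite ltn_eqF.
Qed.

(* Independence of the frequencies and 1 is stated triangularly, so that it is
   inherited by initial segments. *)
Lemma mean_fejer_weight (d : nat) :
  (forall (r : nat) (q : nat -> int) (z : int), (r < d)%N -> q r != 0 ->
     \sum_(j < r.+1) (q j)%:~R * theta j != z%:~R) ->
  mean (weight d) n @[n --> \oo] --> (K%:R ^- d : R).
Proof.
elim: d => [|r IH] indep.
  rewrite expr0 invr1; apply: cvg_near_cst; near=> n.
  rewrite -[RHS](@mean_cst 1 n).
    congr (_ * _); apply: eq_bigr => k _.
    by rewrite /fejer_weight big_ord0.
  by near: n; exists 1%N.
have -> : mean (weight r.+1) = (fun n => K%:R^-2 * \sum_(a < K) \sum_(b < K)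
    mean (fun k => cos (2 * pi * (k%:R * ((a%:R - b%:R) * theta r) +
                    (a%:R - b%:R) * beta r)) * weight r k) n).
  apply/funext => n; under eq_bigr do rewrite -mean_sum.
  rewrite -mean_sum -meanM /mean; congr (_ * _); apply: eq_bigr => k _.
  by rewrite fejer_weightS.
(* Only the [K] diagonal terms have a nonzero limit, so [K^-2] becomes [K^-1]. *)
rewrite [X in _ --> X](_ : K%:R ^- r.+1 =
    K%:R^-2 * \sum_(a < K) \sum_(b < K | b == a) K%:R ^- r); last first.
  under eq_bigr do rewrite big_pred1_eq.
  rewrite sumr_const card_ord -[X in _ * X]mulr_natr exprS.
  have KR : K%:R != 0 :> R by rewrite pnatr_eq0 -lt0n.
  by field; rewrite ?expf_neq0 ?KR.
apply: cvgM (cvg_cst _) _; apply: cvg_sum => a _.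
rewrite [in X in _ --> X]big_mkcond/=.
apply: cvg_sum => b _; case: eqVneq => [->|ba].
  under eq_fun do under eq_fun do
    rewrite subrr !mul0r mulr0 addr0 mulr0 cos0 mul1r.
  by apply: IH => r' q z r'r; apply: indep; exact: ltnW.
apply: mean_cos_fejer_weight => q z; apply/eqP => E.
(* Off the diagonal, the last coefficient [a - b] is nonzero, as the triangular hypothesis
   requires. *)
set q' := fun j : nat => if j == r then a%:Z - b%:Z else q j.
have q'r : q' r != 0.
  rewrite /q' eqxx; move: ba; rewrite -val_eqE/=; lia.
have /eqP := indep r q' z (ltnSn r) q'r; apply.
rewrite /q' big_ord_recr/= eqxx -E addrC intrB -!pmulrn; congr (_ + _).
by apply: eq_bigr => j _; rewrite ltn_eqF.
Unshelve. all: by end_near. Qed.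

End weyl.

(** * Bounding orbit frequencies by counts of grid points *)

Section grid_sandwich.
Context {R : realType}.
Implicit Types (x t : R).

Definition frac x : R := x - (Num.floor x)%:~R.

Lemma frac_itv x : 0 <= frac x < 1.
Proof.
rewrite /frac subr_ge0 floor_le/= ltrBlDr addrC -[X in _ < _ + X]/(1%:~R).
by rewrite -intrD floorD1_gt.
Qed.

Lemma sum_indic_lt K t : 0 <= t -> \sum_(a < K | a%:R < t) 1 <= t + 1.
Proof.
move=> t0; elim: K => [|K IH]; first by rewrite big_ord0 addr_ge0.
rewrite big_mkcond big_ord_recr/= -big_mkcond/=; case: ifPn => [Kt|_].
  rewrite lerD// (le_trans _ (ltW Kt))//.
  have : \sum_(a < K | a%:R < t) 1 <= \sum_(a < K) (1 : R).
    by rewrite big_mkcond/= ler_sum// => a _; case: ifPn.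
  by rewrite [X in _ <= X -> _]sumr_const card_ord.
by rewrite addr0.
Qed.

Variables (d K : nat).
Hypothesis K0 : (0 < K)%N.
Local Notation grid := {ffun 'I_d -> 'I_K}.

(** The constraint is absorbed into the factor [j0]; the sum of products then factorises, and the
    other factors are 1. *)
Lemma sum_grid_marginal (F : 'I_d -> 'I_K -> R) (j0 : 'I_d) (P : pred 'I_K) :
  (forall j, \sum_a F j a = 1) ->
  \sum_(l : grid | P (l j0)) \prod_j F j (l j) = \sum_(a | P a) F j0 a.
Proof.
move=> F1.
pose G j a := if j == j0 then if P a then F j a else 0 else F j a.
transitivity (\prod_j \sum_a G j a).
  rewrite bigA_distr_bigA/= big_mkcond/=; apply: eq_bigr => l _.
  case: ifPn => [Pl|nPl].
    by apply: eq_bigr => j _; rewrite /G; case: eqP => // ->; rewrite Pl.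
  by rewrite (bigD1 j0)//= /G eqxx (negbTE nPl) mul0r.
rewrite (bigD1 j0)//= [X in _ * X]big1 => [|j jj0].
  by rewrite mulr1 [RHS]big_mkcond; apply: eq_bigr => a _; rewrite /G eqxx.
by rewrite -[RHS](F1 j); apply: eq_bigr => a _; rewrite /G (negbTE jj0).
Qed.

Lemma sum_grid (F : 'I_d -> 'I_K -> R) : (forall j, \sum_a F j a = 1) ->
  \sum_(l : grid) \prod_j F j (l j) = 1.
Proof. by move=> F1; rewrite -bigA_distr_bigA big1. Qed.

(** Indexed by [nat], like [theta] and [beta]; coordinates from [d] on take the default value 0. *)
Definition grid_point (l : grid) (j : nat) : R :=
  (if insub j is Some i then (l i)%:R else 0) / K%:R.

Lemma grid_pointE (l : grid) (j : 'I_d) : grid_point l j = (l j)%:R / K%:R.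
Proof. by rewrite /grid_point valK. Qed.

Variables (theta beta : nat -> R) (delta : R).
Hypothesis delta_itv : 0 < delta <= 1 / 2.

Definition orbit_point k j : R := frac (k%:R * theta j + beta j).

(** Translating by a grid point is only a change of phase, so [mean_fejer_weight] gives all grid
    weights the same asymptotic mean. *)
Definition grid_weight (l : grid) k : R :=
  fejer_weight K theta (fun j => beta j - grid_point l j) d k.

(* [frac] jumps at the integers, so a grid point close to 0 or 1 may be close to
   the orbit on the torus while being far from its fractional part. *)
Definition on_edge (a : nat) : bool :=
  (a%:R / K%:R < delta) || (1 - delta < a%:R / K%:R).

Lemma grid_weightE (l : grid) k : grid_weight l k =
  \prod_(j < d) fejer K (k%:R * theta j + beta j - (l j)%:R / K%:R).
Proof. by apply: eq_bigr => j _; rewrite grid_pointE addrA. Qed.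

Lemma grid_weight_ge0 (l : grid) k : 0 <= grid_weight l k.
Proof. by rewrite grid_weightE prodr_ge0// => j _; exact: fejer_ge0. Qed.

Lemma sin_pi_delta_gt0 : 0 < sin (pi * delta).
Proof.
have /andP[d0 d1] := delta_itv; have p0 := @pi_gt0 R.
by rewrite sin_gt0_pi// mulr_gt0//= gtr_pMr//; lra.
Qed.

(** Off the edge, [|frac x - a / K| <= 1 - delta] is automatic, so being far in the unit interval
    means being far on the torus. *)
Lemma fejer_off_edge (x : R) (a : nat) : ~~ on_edge a ->
  delta <= `|frac x - a%:R / K%:R| ->
  fejer K (x - a%:R / K%:R) <= 2 / (sin (pi * delta) ^+ 2 * K%:R ^+ 2).
Proof.
rewrite /on_edge negb_or -!leNgt => /andP[a0 a1] far.
have /andP[d0 d1] := delta_itv.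
have s0 : 0 < sin (pi * delta) ^+ 2 by rewrite exprn_gt0// sin_pi_delta_gt0.
have ss : sin (pi * delta) ^+ 2 <= sin (pi * (x - a%:R / K%:R)) ^+ 2.
  apply: (@sqr_sin_pi_ge _ _ _ (Num.floor x)) => //.
  rewrite (_ : x - _ - _ = frac x - a%:R / K%:R); last by rewrite /frac; ring.
  rewrite far/=; have /andP[? ?] := frac_itv x.
  by rewrite ler_norml; apply/andP; split; lra.
rewrite invfM [_^-1 * _]mulrC mulrA ler_pdivlMr// mulrC.
apply: (le_trans _ (fejer_far K (x - a%:R / K%:R))).
by rewrite ler_wpM2r// fejer_ge0.
Qed.

(** The weights sum to 1. If [A] holds, a grid point outside [L] has a far coordinate: edge
    coordinates are kept as an error term, and for each of the [d] coordinates the others add up to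
    at most [K] kernel values bounded by [fejer_off_edge]. *)
Lemma indic_le_grid_weights (A : bool) (L : pred grid) k :
  (A -> forall l : grid,
    (forall j : 'I_d, `|orbit_point k j - grid_point l j| < delta) -> L l) ->
  A%:R <= \sum_(l : grid | L l) grid_weight l k +
          (\sum_(j < d) \sum_(l : grid | on_edge (l j)) grid_weight l k +
           d%:R * (2 / (sin (pi * delta) ^+ 2 * K%:R))).
Proof.
move=> AL; set c := 2 / _.
have c0 : 0 <= c by rewrite divr_ge0// mulr_ge0// sqr_ge0.
have w0 := grid_weight_ge0.
have F1 (j : 'I_d) :
    \sum_(a < K) fejer K (k%:R * theta j + beta j - a%:R / K%:R) = 1.
  exact: sum_fejer.
have S1 : \sum_(j < d) \sum_(l : grid | on_edge (l j)) grid_weight l k >= 0.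
  by apply: sumr_ge0 => j _; exact: sumr_ge0.
have dc0 : 0 <= d%:R * c by rewrite mulr_ge0.
case: A AL => [|_]; last first.
  by rewrite addr_ge0 ?addr_ge0//; exact: sumr_ge0.
move=> /(_ isT) AL.
pose far (j : 'I_d) (a : 'I_K) :=
  delta <= `|orbit_point k j - a%:R / K%:R|.
have far_sum j : \sum_(l : grid | far j (l j)) grid_weight l k <=
    \sum_(l : grid | on_edge (l j)) grid_weight l k + c.
  rewrite (bigID (fun l : grid => on_edge (l j)))/=; apply: lerD.
    rewrite big_mkcondl/=; apply: ler_sum => l _.
    by case: ifP.
  under eq_bigr do rewrite grid_weightE.
  rewrite (@sum_grid_marginal
    (fun j a => fejer K (k%:R * theta j + beta j - a%:R / K%:R))
    j (fun a => far j a && ~~ on_edge a))//.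
  apply: (@le_trans _ _
    (\sum_(a < K) 2 / (sin (pi * delta) ^+ 2 * K%:R ^+ 2))).
    rewrite big_mkcond/=; apply: ler_sum => a _; case: ifPn => [/andP[f e]|_].
      exact: fejer_off_edge.
    by rewrite divr_ge0// mulr_ge0// sqr_ge0.
  rewrite sumr_const card_ord -[X in X <= _]mulr_natr /c.
  rewrite le_eqVlt; apply/orP; left; apply/eqP.
  have KR : K%:R != 0 :> R by rewrite pnatr_eq0 -lt0n.
  by field; rewrite KR gt_eqF// sin_pi_delta_gt0.
have tot : \sum_(l : grid) grid_weight l k = 1.
  under eq_bigr do rewrite grid_weightE.
  exact: (@sum_grid
    (fun j a => fejer K (k%:R * theta j + beta j - a%:R / K%:R))).
(* With 1 written as the total weight, the part in [L] cancels and a union bound over the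
   coordinates handles the rest. *)
rewrite (_ : true%:R = \sum_(l : grid) grid_weight l k)//.
rewrite (bigID L)/= lerD2l.
have -> : d%:R * c = \sum_(j < d) c by rewrite sumr_const card_ord mulr_natl.
rewrite -big_split/=; apply: (le_trans _ (ler_sum _ (fun j _ => far_sum j))).
under [leRHS]eq_bigr do rewrite big_mkcond/=.
rewrite exchange_big/= big_mkcond/=; apply: ler_sum => l _.
have term0 j : 0 <= if far j (l j) then grid_weight l k else 0.
  by case: ifP.
case: ifPn => [nL|_]; last exact: sumr_ge0.
have [/existsP[j fj]|/existsPn nfar] := boolP [exists j, far j (l j)].
  by rewrite (bigD1 j)//= fj lerDl sumr_ge0.
case/negP: nL; apply: AL => j; rewrite grid_pointE ltNge; exact: nfar.
Qed.

(** Each end holds at most [delta K + 1] indices; [rev_ord] reflects the upper end onto the lower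
    one. *)
Lemma edge_density :
  \sum_(a < K | on_edge a) K%:R^-1 <= 2 * (delta + K%:R^-1) :> R.
Proof.
have /andP[d0 d1] := delta_itv.
have KR : 0 < K%:R :> R by rewrite ltr0n.
have dK : 0 <= delta * K%:R by rewrite mulr_ge0// ltW.
have h1 := sum_indic_lt K dK.
have h2 : \sum_(a < K | (rev_ord a)%:R < delta * K%:R) 1 <= delta * K%:R + 1.
  rewrite (reindex_inj rev_ord_inj)/=; apply: le_trans h1.
  rewrite le_eqVlt; apply/orP; left; apply/eqP.
  by apply: eq_bigl => a; have := rev_ordK a; move/(congr1 val) => /= ->.
rewrite -[leLHS]mulr1 mulr_suml.
under eq_bigr do rewrite mulrC.
rewrite -mulr_suml ler_pdivrMr//.
apply: (@le_trans _ _ ((delta * K%:R + 1) + (delta * K%:R + 1))); last first.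
  rewrite le_eqVlt; apply/orP; left; apply/eqP.
  by field; rewrite gt_eqF.
apply: le_trans (lerD h1 h2).
rewrite big_mkcond [X in _ <= X + _]big_mkcond [X in _ <= _ + X]big_mkcond/=.
rewrite -big_split/=; apply: ler_sum => a _.
rewrite /on_edge ltr_pdivrMr// ltr_pdivlMr//.
case: ltrP => _ /=; first by rewrite lerDl; case: ifP.
case: ltrP => [e|_]; last by rewrite add0r; case: ifP.
rewrite add0r ifT// natrB//.
rewrite -natr1; lra.
Qed.

Hypothesis indep : forall (r : nat) (q : nat -> int) (z : int),
  (r < d)%N -> q r != 0 -> \sum_(j < r.+1) (q j)%:~R * theta j != z%:~R.

(** The pointwise bound is averaged over [k]: each mean weight tends to [K^-d], and [eps] absorbs
    the convergence. *)
Lemma mean_indic_le (A : nat -> bool) (L : pred grid) (eps : R) : 0 < eps ->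
  (forall k, A k -> forall l : grid,
    (forall j : 'I_d, `|orbit_point k j - grid_point l j| < delta) -> L l) ->
  \forall n \near \oo, mean (fun k => (A k)%:R) n <=
    \sum_(l : grid | L l) K%:R ^- d +
    (d%:R * (2 * (delta + K%:R^-1)) +
     d%:R * (2 / (sin (pi * delta) ^+ 2 * K%:R))) + eps.
Proof.
move=> e0 AL; set c := d%:R * (2 / _).
have cvg_mean (P : pred grid) :
    mean (fun k => \sum_(l : grid | P l) grid_weight l k) n @[n --> \oo] -->
    \sum_(l : grid | P l) (K%:R ^- d : R).
  under eq_fun do rewrite mean_sum.
  by apply: cvg_sum => l _; exact: mean_fejer_weight.
have cvg_rhs : (mean (fun k => \sum_(l : grid | L l) grid_weight l k) n +
    (\sum_(j < d)
      mean (fun k => \sum_(l : grid | on_edge (l j)) grid_weight l k) n + c))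
    @[n --> \oo] --> \sum_(l : grid | L l) K%:R ^- d +
    (\sum_(j < d) \sum_(l : grid | on_edge (l j)) K%:R ^- d + c).
  apply: cvgD => //; apply: cvgD; last exact: cvg_cst.
  by apply: cvg_sum => j _; exact: cvg_mean.
have edges : \sum_(j < d) \sum_(l : grid | on_edge (l j)) K%:R ^- d <=
    d%:R * (2 * (delta + K%:R^-1)).
  rewrite (_ : d%:R * _ = \sum_(j < d) 2 * (delta + K%:R^-1)); last first.
    by rewrite sumr_const card_ord mulr_natl.
  apply: ler_sum => j _.
  have KR : K%:R != 0 :> R by rewrite pnatr_eq0 -lt0n.
  apply: le_trans edge_density.
  rewrite -(@sum_grid_marginal (fun _ _ => K%:R^-1) j on_edge); last first.
    by move=> _; rewrite sumr_const card_ord -[_ *+ K]mulr_natr mulVf.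
  by under [leRHS]eq_bigr do rewrite prodr_const card_ord exprVn.
near=> n.
apply: (@le_trans _ _ (mean (fun k => \sum_(l : grid | L l) grid_weight l k +
    (\sum_(j < d) \sum_(l : grid | on_edge (l j)) grid_weight l k + c)) n)).
  by apply: le_mean => k; apply: indic_le_grid_weights => /AL.
rewrite meanD [X in _ + X <= _]meanD [X in _ + (X + _) <= _]mean_sum.
rewrite mean_cst; last by near: n; exists 1%N.
apply: (@le_trans _ _ (\sum_(l : grid | L l) K%:R ^- d +
    (\sum_(j < d) \sum_(l : grid | on_edge (l j)) K%:R ^- d + c) + eps)).
  by near: n; move: cvg_rhs => /cvgr_le; apply; rewrite ltrDl.
by rewrite lerD2r lerD2l lerD2r.
Unshelve. all: by end_near. Qed.

End grid_sandwich.

(** * The quota method *)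

Section quota.
Context {R : realType}.
Implicit Types (gamma x t : R).

(** [D - frac t] is an integer lying strictly between -2 and 1, hence -1 or 0. *)
Lemma frac_between (t D : R) (e : int) : D = t + e%:~R -> -1 < D < 1 ->
  frac t - 1 <= D <= frac t.
Proof.
move=> DE /andP[D1 D2]; have /andP[f0 f1] := frac_itv t.
pose q := e + Num.floor t.
have Dq : D = frac t + q%:~R by rewrite DE /frac /q intrD; ring.
have q1 : q%:~R < (1%:~R : R) by rewrite -[1%:~R]/(1 : R); lra.
have q2 : (- 2)%:~R < (q%:~R : R) by rewrite mulrNz -[2%:~R]/(2 : R); lra.
move: q1 q2; rewrite !ltr_int => q1 q2.
have q1' : q%:~R <= (0%:~R : R) by rewrite ler_int; lia.
have q2' : (- 1)%:~R <= (q%:~R : R) by rewrite ler_int; lia.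
move: q1' q2'; rewrite mulrNz -[1%:~R]/(1 : R) -[0%:~R]/(0 : R) => q1' q2'.
by apply/andP; split; lra.
Qed.

Lemma quota_excess_le (m : nat) (p : 'I_m.+2 -> R) gamma (N : nat)
    (s : 'I_m.+2 -> int) (i : 'I_m.+2) x :
  \sum_j p j = 1 -> quota_allocation gamma p N s ->
  (forall j (z : int), j != i -> (N%:R + gamma) * (p j - p i) != z%:~R) ->
  ((s i)%:~R - N%:R * p i <= x) =
  (frac (N%:R * p i + x) +
    1 / m.+2%:R * \sum_(r < m)
      frac ((N%:R + gamma) * (p (lift i (lift ord0 r)) - p i)) <
   x - gamma * (p i - 1 / m.+2%:R) + m.+1%:R / m.+2%:R).
Proof.
move=> p1 [sN [alpha rnd]] notint.
set Delta := (s i)%:~R - _.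
pose D j : R := (s i)%:~R - (s j)%:~R + (N%:R + gamma) * (p j - p i).
pose E j : R := frac ((N%:R + gamma) * (p j - p i)).
have D_itv j : j != i -> -1 < D j < 1.
  move=> ji; have := rnd i; have := rnd j; rewrite /alpha_rounding.
  move=> /andP[j1 j2] /andP[i1 i2].
  (* Ties allow [D j] to reach -1 or 1 in the rounding inequalities, but either value would make
     [(N + gamma) (p j - p i)] an integer. *)
  have Dn1 : D j != -1.
    apply/eqP => D1; have /eqP := notint j (s j - s i - 1) ji; apply.
    by rewrite !intrB -[1%:~R]/(1 : R); move: D1; rewrite /D; lra.
  have D1 : D j != 1.
    apply/eqP => D1; have /eqP := notint j (s j - s i + 1) ji; apply.
    by rewrite intrD !intrB -[1%:~R]/(1 : R); move: D1; rewrite /D; lra.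
  rewrite !lt_neqAle D1 [-1 == _]eq_sym Dn1/=.
  by apply/andP; split; rewrite /D; lra.
have DE j : j != i -> E j - 1 <= D j <= E j.
  move=> ji; apply: (@frac_between _ _ (s i - s j)); last exact: D_itv.
  by rewrite /D intrB addrC.
(* Summing [D] over all parties brings in the totals [N] of the seats and 1 of the proportions;
   [D i] is 0. *)
have mDelta : m.+2%:R * Delta = gamma * (m.+2%:R * p i - 1) +
    \sum_(r < m.+1) D (lift i r).
  have Di : D i = 0 by rewrite /D; ring.
  have -> : \sum_(r < m.+1) D (lift i r) = \sum_j D j.
    by rewrite [RHS](bigD1_ord i)//= Di add0r.
  rewrite /D big_split/= sumrB -mulr_sumr sumrB p1 !sumr_const card_ord.
  have -> : \sum_j (s j)%:~R = N%:R :> R.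
    by have := congr1 (fun z : int => z%:~R : R) sN; rewrite rmorph_sum.
  rewrite -[_ *+ m.+2]mulr_natl -[p i *+ m.+2]mulr_natl /Delta; ring.
have m0 : 0 < m.+2%:R :> R by rewrite ltr0n.
set S := \sum_(r < m) _.
have SE : S = \sum_(r < m) E (lift i (lift ord0 r)) by [].
pose b := gamma * (p i - 1 / m.+2%:R) + 1 / m.+2%:R * S - m.+1%:R / m.+2%:R.
have bE : m.+2%:R * b = gamma * (m.+2%:R * p i - 1) + S - m.+1%:R.
  by rewrite /b; field; rewrite gt_eqF.
have neq_lift_i r : lift i r != i by rewrite eq_sym neq_lift.
have [Sl Su] : \sum_(r < m) D (lift i (lift ord0 r)) >= S - m%:R /\
    \sum_(r < m) D (lift i (lift ord0 r)) <= S.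
  rewrite SE (_ : m%:R = \sum_(r < m) 1); last by rewrite sumr_const card_ord.
  rewrite -sumrB.
  split; apply: ler_sum => r _;
    by have /andP[] := DE _ (neq_lift_i (lift ord0 r)).
(* This party is confined only to [(-1, 1)]; the other [m] differences have range 1 each. The total
   range [m + 2], divided by [m + 2], gives [Delta] an open interval of length exactly 1. *)
have /andP[k1 k2] := D_itv _ (neq_lift_i ord0).
move: mDelta; rewrite big_ord_recl/= => mDelta.
have bl : b < Delta.
  by rewrite -(ltr_pM2l m0) bE mDelta -natr1; lra.
have bu : Delta < b + 1.
  rewrite -(ltr_pM2l m0) [ltRHS]mulrDr mulr1 bE mDelta.
  by rewrite -[X in _ < _ + X]natr1 -natr1; lra.
have -> : x - gamma * (p i - 1 / m.+2%:R) + m.+1%:R / m.+2%:R =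
    x - b + 1 / m.+2%:R * S by rewrite /b; ring.
rewrite ltrD2r.
have /andP[T0 T1] := frac_itv (N%:R * p i + x).
(* The sign of [q] decides both sides: for [0 <= q] both hold, by [b < Delta]; for [q <= -1] both
   fail, by [Delta < b + 1]. *)
pose q := Num.floor (N%:R * p i + x) - s i.
have xD : x - Delta = frac (N%:R * p i + x) + q%:~R.
  by rewrite /frac /q intrB /Delta; ring.
have [q0|q0] := leP 0 q.
  have q0' : 0%:~R <= (q%:~R : R) by rewrite ler_int.
  rewrite -[0%:~R]/(0 : R) in q0'.
  by apply/idP/idP => _; lra.
have q1 : q%:~R <= ((-1)%:~R : R) by rewrite ler_int; lia.
rewrite mulrNz -[1%:~R]/(1 : R) in q1.
by apply/idP/idP => ?; lra.
Qed.

End quota.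

(** * Rational independence of the frequencies *)

Section frequencies.
Context {R : realType}.

Lemma Q_linearly_independent_int (m : nat) (p : 'I_m -> R) :
  Q_linearly_independent p -> forall c : 'I_m -> int,
  \sum_i (c i)%:~R * p i = 0 -> forall i, c i = 0.
Proof.
move=> indep c c0 i; have := indep (fun i => (c i)%:~R) _ i.
move=> /(_ _)/eqP; rewrite intr_eq0 => h; apply/eqP/h.
by rewrite -[RHS]c0; apply: eq_bigr => j _; rewrite ratr_int.
Qed.

Variables (m : nat) (p : 'I_m.+2 -> R).
Hypotheses (p_sum : \sum_j p j = 1) (p_indep : Q_linearly_independent p).

(** Index 0 is taken by [p i], so party [lift i ord0] never occurs: it is the one whose fractional
    part is left out. *)
Definition excess_freq (i : 'I_m.+2) (r : nat) : R :=
  if r == 0%N then p i else p (lift i (inord r : 'I_m.+1)) - p i.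

Lemma excess_freqS i (r : 'I_m) :
  excess_freq i r.+1 = p (lift i (lift ord0 r)) - p i.
Proof.
rewrite /excess_freq/=; congr (p (lift i _) - _).
by apply: val_inj; rewrite /= inordK ?ltnS.
Qed.

(** Since the [p k] sum to 1, [z] is the sum of the [z p k], and an integer relation with 1 becomes
    a homogeneous relation [c] among the [p k]. *)
Lemma excess_freq_indep i (r : nat) (q : nat -> int) (z : int) :
  (r < m.+1)%N -> q r != 0 ->
  \sum_(j < r.+1) (q j)%:~R * excess_freq i j != z%:~R.
Proof.
move=> rm qr; apply/eqP => E.
pose q' j := if (j < r.+1)%N then q j else 0.
have {}E : \sum_(j < m.+1) (q' j)%:~R * excess_freq i j = z%:~R.
  rewrite -E (big_ord_widen m.+1 (fun j => (q j)%:~R * excess_freq i j))//.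
  rewrite [RHS]big_mkcond/=; apply: eq_bigr => j _.
  by rewrite /q'; case: ifP => // _; rewrite mul0r.
move: E; rewrite big_ord_recl/=.
under eq_bigr do rewrite /bump leq0n add1n excess_freqS.
rewrite {1}/excess_freq/= => E.
pose c k := if unlift i k is Some j then
    (if j == ord0 then 0 else q' j) - z
  else q' 0%N - \sum_(j < m) q' j.+1 - z.
have c_lift j : c (lift i j) = (if j == ord0 then 0 else q' j) - z.
  by rewrite /c liftK.
have c_i : c i = q' 0%N - \sum_(j < m) q' j.+1 - z by rewrite /c unlift_none.
have c0 : \sum_k (c k)%:~R * p k = 0.
  have -> : \sum_k (c k)%:~R * p k = \sum_k (c k + z)%:~R * p k - z%:~R.
    have zE : z%:~R = \sum_k z%:~R * p k by rewrite -mulr_sumr p_sum mulr1.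
    rewrite [X in _ = _ - X]zE -sumrB.
    by apply: eq_bigr => k _; rewrite intrD; ring.
  rewrite -E (bigD1_ord i)//= c_i big_ord_recl/= c_lift eqxx subrK.
  rewrite subrK mulr0z mul0r add0r.
  under [X in _ + X - _]eq_bigr do rewrite c_lift/= subrK /bump leq0n add1n.
  rewrite intrB rmorph_sum/= mulrBl mulr_suml.
  under [in X in _ - X]eq_bigr do rewrite mulrBr.
  rewrite sumrB; ring.
have call := Q_linearly_independent_int p_indep c0.
(* The omitted party carries the coefficient [-z] alone, which forces [z = 0] before the other
   coefficients are read off. *)
have z0 : z = 0 by have := call (lift i ord0); rewrite c_lift eqxx; lia.
have qS (j : 'I_m) : q' j.+1 = 0.
  by have := call (lift i (lift ord0 j)); rewrite c_lift/= z0 subr0.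
have q0 : q' 0%N = 0.
  by have := call i; rewrite c_i z0 big1 ?subr0// => j _; exact: qS.
move: qr; have -> : q r = q' r by rewrite /q' ltnSn.
suff -> : q' r = 0 by [].
have [r0|r0] := posnP r; first by rewrite [in q' _]r0.
have rm' : (r.-1 < m)%N by lia.
by rewrite -[r in q' r](prednK r0) (qS (Ordinal rm')).
Qed.

(** At most one [N] is exceptional: the difference of two integer values no longer involves [gamma]
    and is a relation among the [p k]. *)
Lemma shifted_difference_not_int gamma i j : j != i ->
  \forall N \near \oo, forall z : int, (N%:R + gamma) * (p j - p i) != z%:~R.
Proof.
move=> ji.
have [[N0 [z0 E0]]|noN] := pselect (exists N (z : int),
    (N%:R + gamma) * (p j - p i) = z%:~R); last first.
  by near=> N; move=> z; apply/eqP => E; apply: noN; exists N, z.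
exists N0.+1 => //= N N0N z; apply/eqP => E.
have [n nE] : exists n : int, n = N%:Z - N0%:Z by exists (N%:Z - N0%:Z).
have [w wE] : exists w : int, w = z - z0 by exists (z - z0).
pose c k : int := (if k == j then n else 0) - (if k == i then n else 0) - w.
have c0 : \sum_k (c k)%:~R * p k = 0.
  rewrite /c; under eq_bigr do rewrite !intrB !mulrBl.
  rewrite !sumrB -mulr_sumr p_sum mulr1.
  rewrite (bigD1 j)//= eqxx big1 => [|k /negbTE ->]; last by rewrite mul0r.
  rewrite addr0 (bigD1 i)//= eqxx big1 => [|k /negbTE ->]; last by rewrite mul0r.
  by rewrite addr0 wE nE !intrB -!pmulrn -E -E0; ring.
have call := Q_linearly_independent_int p_indep c0.
have := call i; have := call j; rewrite /c !eqxx [i == j]eq_sym (negbTE ji).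
move=> /eqP h1 /eqP h2; move: N0N h1 h2; rewrite /= => N0N h1 h2; lia.
Unshelve. all: by end_near. Qed.

Lemma near_quota_regular gamma i :
  \forall N \near \oo, 0 < N%:R + gamma /\
    forall j (z : int), j != i -> (N%:R + gamma) * (p j - p i) != z%:~R.
Proof.
have all_j : \forall N \near \oo, forall j, j != i ->
    forall z : int, (N%:R + gamma) * (p j - p i) != z%:~R.
  apply: filter_forall => j; have [->|ji] := eqVneq j i.
    exact: filterE.
  by apply: filterS (shifted_difference_not_int gamma ji) => N.
near=> N; split; last first.
  by move=> j z ji; move: j ji z; near: N.
by rewrite -ltrBlDr sub0r; near: N; exact: nbhs_infty_gtr.
Unshelve. all: by end_near. Qed.

End frequencies.

(** * Uniform variables *)

Section probability_bounds.
Context {R : realType} {d0 : measure_display} {T : measurableType d0}.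
Variable P : probability T R.
Local Open Scope ereal_scope.

Lemma probabilityU2 (A B : set T) : measurable A -> measurable B ->
  P (A `|` B) <= P A + P B.
Proof. exact: measureU2. Qed.

Lemma probability_cover_le (I : finType) (L : pred I) (F : I -> set T)
    (E B : set T) :
  measurable E -> measurable B -> (forall i, measurable (F i)) -> P B = 0 ->
  (forall w, E w -> B w \/ exists2 i, L i & F i w) ->
  P E <= \sum_(i | L i) P (F i).
Proof.
move=> mE mB mF B0 EBF.
have mU : measurable (\big[setU/set0]_(i | L i) F i).
  by apply: bigsetU_measurable => i _.
have PU : P (\big[setU/set0]_(i | L i) F i) <= \sum_(i | L i) P (F i).
  suff [] : P (\big[setU/set0]_(i | L i) F i) <= \sum_(i | L i) P (F i) /\
    measurable (\big[setU/set0]_(i | L i) F i) by [].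
  elim/big_rec2 : _ => [|i y A _ [PA mA]]; first by rewrite measure0.
  split; last exact: measurableU.
  by apply: (le_trans (probabilityU2 _ _)) => //; rewrite leeD2l.
apply: (@le_trans _ _ (P (B `|` \big[setU/set0]_(i | L i) F i))).
  rewrite le_measure ?inE//; first exact: measurableU.
  move=> w /EBF[Bw|[i Li Fi]]; [by left|right].
  by rewrite -bigcup_pred; exists i.
by apply: (le_trans (probabilityU2 _ _)) => //; rewrite B0 add0e.
Qed.

(** The small values of [N], on which [E] is not controlled, cost at most [(M + 1) / n], which
    vanishes in the limit. *)
Lemma uniform_1_to_le (n : nat) (N : {RV P >-> nat}) (E : set T)
    (A : nat -> bool) (M : nat) : (0 < n)%N -> uniform_1_to n N ->
  measurable E ->
  {ae P, forall w, (M <= N w)%N -> E w -> A (N w)} ->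
  P E <= (mean (fun k => (A k)%:R) n + M.+1%:R / n%:R)%:E.
Proof.
move=> n0 uN mE [B [mB B0 AB]].
have nR : n%:R != 0%R :> R by rewrite pnatr_eq0 -lt0n.
have mN (X : set nat) : measurable (N @^-1` X).
  by rewrite -[_ @^-1` _]setTI; exact: measurable_funPT.
(* [uniform_1_to] prescribes only the masses of 1, ..., [n]; they add up to 1, so all other values
   are null. *)
have N_in : P (N @^-1` [set k | (1 <= k <= n)%N]) = 1.
  have -> : N @^-1` [set k | (1 <= k <= n)%N] =
      \big[setU/set0]_(k < n) (N @^-1` [set k.+1]).
    rewrite -(bigcup_mkord n (fun k => N @^-1` [set k.+1])).
    apply/seteqP; split => w /=.
      by case Nw : (N w) => [|k]// kn; exists k.
    by move=> [k/= kn ->].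
  rewrite (measure_bigsetU P (F := fun k => N @^-1` [set k.+1]))//.
    rewrite (eq_bigr (fun=> (n%:R^-1)%:E)); last first.
      by move=> k _; apply: uN; rewrite /= ltn_ord.
    by rewrite sumEFin sumr_const card_ord -[(_ *+ n)%R]mulr_natr mulVf.
  by move=> i j _ _ [w /= [-> [->]]].
have B'0 : P (B `|` ~` (N @^-1` [set k | (1 <= k <= n)%N])) = 0.
  apply/eqP; rewrite eq_le measure_ge0 andbT.
  apply: (le_trans (probabilityU2 _ _)) => //; first exact: measurableC.
  by rewrite probability_setC// N_in subee// B0 adde0.
pose L (k : 'I_n) := A k.+1 || (k < M)%N.
apply: (@le_trans _ _ (\sum_(k < n | L k) P (N @^-1` [set k.+1]))).
  apply: probability_cover_le B'0 _ => //.
    by apply: measurableU => //; exact: measurableC.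
  move=> w Ew; case Nw : (1 <= N w <= n)%N; last first.
    by left; right => /=; rewrite Nw.
  have [Bw|nBw] := pselect (B w); first by left; left.
  right; have Nn : ((N w).-1 < n)%N by move: Nw; lia.
  exists (Ordinal Nn); last by rewrite /=; move: Nw; lia.
  rewrite /L /= prednK; last by move: Nw; lia.
  have [MN|] := leqP M (N w); last by move: Nw => ? ?; apply/orP; right; lia.
  apply/orP; left; apply: contrapT => nA; apply: nBw.
  by apply: AB => /(_ MN Ew).
rewrite (eq_bigr (fun=> (n%:R^-1)%:E)); last first.
  by move=> k _; apply: uN; rewrite /= ltn_ord.
rewrite sumEFin lee_fin /mean mulr_sumr.
apply: (@le_trans _ _ (\sum_(k < n) (n%:R^-1 * (A k.+1)%:R + n%:R^-1 *
   (if (k%:R < M%:R :> R) then 1 else 0)))%R).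
  rewrite big_mkcond/=; apply: ler_sum => k _; rewrite /L ltr_nat.
  case: (A _) => /=; rewrite ?mulr1 ?mulr0 ?add0r.
    by rewrite lerDl mulr_ge0//; case: ifP.
  by case: ifP; rewrite ?mulr1 ?mulr0.
rewrite big_split/= lerD2l -mulr_sumr mulrC ler_wpM2r// -big_mkcond/=.
by rewrite -natr1; exact: sum_indic_lt.
Qed.

End probability_bounds.

(** * Independent uniform variables and grid cells *)

Section uniform_grid.
Context {R : realType} {d' : measure_display} {T' : measurableType d'}.
Variable Q : probability T' R.
Local Open Scope ereal_scope.

Lemma uniform_prob_itv (a b : R) : (- (1 / 2) <= a)%R -> (a <= b)%R ->
  (b <= 1 / 2)%R ->
  uniform_prob (half_interval R) `[a, b[%classic = (b - a)%:E.
Proof.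
move=> la ab bu; rewrite /uniform_prob.
rewrite (eq_integral (fun=> 1)); last first.
  move=> x; rewrite inE/= in_itv/= => /andP[ax xb]; rewrite /uniform_pdf.
  rewrite ifT; last by apply/andP; split; lra.
  by congr (_%:E); field.
rewrite integral_cst//= mul1e lebesgue_measure_itv/= lte_fin.
case: ltgtP ab => [ab _|//|-> _]; first by rewrite EFinB.
by rewrite subrr.
Qed.

Variables (d K : nat) (U : nat -> {RV Q >-> R}).
Hypothesis K0 : (0 < K)%N.
Hypothesis U_unif : forall k, (k < d)%N -> uniform_half (U k).
Hypothesis U_indep : mutually_independent [set k : nat | (k < d)%N] U.
Local Notation grid := {ffun 'I_d -> 'I_K}.

Definition grid_itv (l : grid) (j : nat) : set R :=
  `[(grid_point l j - 1 / 2)%R, (grid_point l j + K%:R^-1 - 1 / 2)%R[%classic.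

(** The index set is a finite set of naturals, the form to which [mutually_independent] applies. *)
Definition grid_cell (l : grid) : set T' :=
  \bigcap_(j in [set` [fset j in iota 0 d]%fset]) (U j @^-1` grid_itv l j).

Lemma measurable_grid_itv (l : grid) j : measurable (U j @^-1` grid_itv l j).
Proof.
rewrite -[_ @^-1` _]setTI; apply: measurable_funPT => //.
exact: measurable_itv.
Qed.

Lemma measurable_grid_cell (l : grid) : measurable (grid_cell l).
Proof.
apply: fin_bigcap_measurable => //.
by move=> j _; exact: measurable_grid_itv.
Qed.

Lemma probability_grid_cell (l : grid) : Q (grid_cell l) = (K%:R ^- d)%:E.
Proof.
have KR : (0 < K%:R :> R)%R by rewrite ltr0n.
rewrite /grid_cell U_indep; last 2 first.
- by move=> j /=; rewrite !inE mem_iota.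
- by move=> j _; exact: measurable_itv.
rewrite (eq_big_seq (fun=> (K%:R^-1)%:E)); last first.
  move=> j; rewrite !inE mem_iota/= add0n => jd.
  have := @U_unif j jd (grid_itv l j) (measurable_itv _).
  rewrite /distribution/= /pushforward => ->.
  rewrite uniform_prob_itv.
  - by congr (_%:E); ring.
  - rewrite /grid_point lerBrDl subrr divr_ge0//.
    by case: insubP.
  - by rewrite lerD2r lerDl invr_ge0 ltW.
  suff : (grid_point l j + K%:R^-1 <= 1 :> R)%R by lra.
  rewrite (grid_pointE (R := R) l (Ordinal jd)) -[X in (_ + X)%R]mul1r -mulrDl.
  by rewrite ler_pdivrMr// mul1r natr1 ler_nat.
rewrite prodEFin big_const_seq/= count_predT iter_mulr_1 exprVn.
congr ((_ ^- _)%:E).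
by rewrite card_fseq undup_id ?size_iota// iota_uniq.
Qed.

Lemma uniform_half_outside (k : nat) : (k < d)%N ->
  Q (U k @^-1` (~` `[(- (1 / 2))%R, (1 / 2)%R[%classic)) = 0.
Proof.
move=> kd.
have := U_unif kd (measurableC (measurable_itv `[(- (1 / 2))%R, (1 / 2)%R[)).
rewrite /distribution/= /pushforward => ->.
rewrite (_ : uniform_prob _ _ = 1 - uniform_prob (half_interval R)
    `[(- (1 / 2))%R, (1 / 2)%R[%classic); last first.
  by apply: probability_setC; exact: measurable_itv.
rewrite uniform_prob_itv//; last by lra.
rewrite (_ : (1 / 2 - - (1 / 2) = 1)%R); last by field.
by rewrite subee.
Qed.

(** Almost surely the shifted uniforms lie in a grid cell, so [E] is covered, up to a null set, by
    the cells it meets, each of mass [K^-d]. *)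
Lemma probability_grid_le (E : set T') (L : pred grid) : measurable E ->
  (forall (w : T') (l : grid), E w ->
    (forall j : 'I_d,
      (grid_point l j <= U j w + 1 / 2 < grid_point l j + K%:R^-1)%R) -> L l) ->
  Q E <= (\sum_(l : grid | L l) K%:R ^- d)%:E.
Proof.
move=> mE EL; have KR : (0 < K%:R :> R)%R by rewrite ltr0n.
rewrite -sumEFin.
under eq_bigr => l _ do rewrite -(probability_grid_cell l).
pose out (j : 'I_d) := U j @^-1` (~` `[(- (1 / 2))%R, (1 / 2)%R[%classic).
have mout j : measurable (out j).
  rewrite -[out j]setTI; apply: measurable_funPT => //.
  by apply: measurableC; exact: measurable_itv.
have mB : measurable (\big[setU/set0]_(j < d) out j).
  exact: bigsetU_measurable.
have outP w : (\big[setU/set0]_(j < d) out j) w <-> exists j, out j w.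
  rewrite -bigcup_pred; split; first by move=> [j _ oj]; exists j.
  by move=> [j oj]; exists j.
apply: (probability_cover_le mE mB (fun l => measurable_grid_cell l)).
  apply/eqP; rewrite eq_le measure_ge0 andbT.
  apply: (@le_trans _ _ (\sum_(j < d) Q (out j))).
    apply: (@probability_cover_le _ _ _ _ _ _ _ _ set0) => //.
    by move=> w /outP[j oj]; right; exists j.
  by rewrite big1// => j _; exact: uniform_half_outside.
move=> w Ew; have [/outP|nout] := pselect ((\big[setU/set0]_(j < d) out j) w).
  by move=> oj; left; exact/outP.
right.
have U_itv (j : 'I_d) : (0 <= U j w + 1 / 2 < 1)%R.
  have : ~ out j w by move=> oj; apply: nout; apply/outP; exists j.
  rewrite /out/= => /contrapT; rewrite in_itv/= => /andP[? ?].
  by apply/andP; split; lra.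
have lt_K (j : 'I_d) : (`|Num.floor (K%:R * (U j w + 1 / 2))%R|%N < K)%N.
  have /andP[u0 u1] := U_itv j.
  have f0 : (0 <= Num.floor (K%:R * (U j w + 1 / 2)))%R.
    by rewrite floor_ge_int mulr_ge0// ltW.
  have : (Num.floor (K%:R * (U j w + 1 / 2)) < K%:Z)%R.
    by rewrite floor_lt_int -pmulrn gtr_pMr.
  lia.
pose l : grid := [ffun j => Ordinal (lt_K j)].
have l_cell (j : 'I_d) :
    (grid_point l j <= U j w + 1 / 2 < grid_point l j + K%:R^-1)%R.
  have /andP[u0 u1] := U_itv j.
  rewrite grid_pointE ffunE/= -[X in (_ < _ + X)%R]mul1r -mulrDl.
  rewrite ler_pdivrMr// ltr_pdivlMr//.
  have f0 : (0 <= Num.floor (K%:R * (U j w + 1 / 2)))%R.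
    by rewrite floor_ge_int mulr_ge0// ltW.
  rewrite pmulrn gez0_abs// mulrC floor_le/=.
  by have := floorD1_gt ((U j w + 1 / 2) * K%:R)%R; rewrite intrD.
exists l; first exact: EL Ew l_cell.
move=> j /=; rewrite !inE mem_iota/= add0n => jd.
have /andP[/= ? ?] := l_cell (Ordinal jd).
by rewrite /grid_itv/= in_itv/=; apply/andP; split; lra.
Qed.

End uniform_grid.

(** * Passage to the limit *)

Section limit_comparison.
Context {R : realType}.

Lemma sum_grid_cst (d K : nat) : (0 < K)%N ->
  \sum_(l : {ffun 'I_d -> 'I_K}) K%:R ^- d = 1 :> R.
Proof.
move=> K0; have KR : K%:R != 0 :> R by rewrite pnatr_eq0 -lt0n.
transitivity (\sum_(l : {ffun 'I_d -> 'I_K}) \prod_(j < d) (K%:R^-1 : R)).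
  by apply: eq_bigr => l _; rewrite prodr_const card_ord exprVn.
apply: (@sum_grid R d K (fun _ _ => K%:R^-1)) => j.
by rewrite sumr_const card_ord -[_ *+ K]mulr_natr mulVf.
Qed.

Variables (d : nat -> measure_display) (T : forall n, measurableType (d n)).
Variables (P : forall n, probability (T n) R) (N : forall n, {RV (P n) >-> nat}).
Hypothesis N_unif : forall n, (0 < n)%N -> uniform_1_to n (N n).
Variables (d' : measure_display) (T' : measurableType d').
Variables (Q : probability T' R) (D : nat) (U : nat -> {RV Q >-> R}).
Hypothesis U_unif : forall k, (k < D)%N -> uniform_half (U k).
Hypothesis U_indep : mutually_independent [set k : nat | (k < D)%N] U.
Variables (theta beta : nat -> R).
Hypothesis indep : forall (r : nat) (q : nat -> int) (z : int),
  (r < D)%N -> q r != 0 -> \sum_(j < r.+1) (q j)%:~R * theta j != z%:~R.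

(** Both probabilities are compared with the proportion of grid points in one set [L]. The error is
    [4 D delta] for the edges, plus [delta] each for the kernel tail, the convergence of means and
    the small values of [N]. *)
Lemma probability_limit_le (delta : R) (E : forall n, set (T n)) (G : set T')
    (A : nat -> bool) (M : nat) : 0 < delta <= 1 / 2 ->
  (forall n, measurable (E n)) -> measurable G ->
  (forall n, (0 < n)%N ->
    {ae P n, forall w, (M <= N n w)%N -> E n w -> A (N n w)}) ->
  (forall k w, A k -> (forall j : 'I_D,
    `|orbit_point theta beta k j - (U j w + 1 / 2)| < 2 * delta) -> G w) ->
  \forall n \near \oo,
    (P n (E n) <= Q G + ((4 * D%:R + 3) * delta)%:E)%E.
Proof.
move=> delta_itv mE mG EA AG.
have /andP[d0 d1] := delta_itv.
have s0 : 0 < sin (pi * delta) ^+ 2 by rewrite exprn_gt0// sin_pi_delta_gt0.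
have [K [K0 Kdelta Ksin]] : exists K : nat, [/\ (0 < K)%N, K%:R^-1 <= delta &
    D%:R * (2 / (sin (pi * delta) ^+ 2 * K%:R)) <= delta].
  near \oo => K; exists K.
  have K0 : (0 < K)%N by near: K; exists 1%N.
  have KR : 0 < K%:R :> R by rewrite ltr0n.
  split=> //.
    by rewrite invf_ple ?posrE//; near: K; exact: nbhs_infty_ger.
  have KD : D%:R * 2 / (sin (pi * delta) ^+ 2 * delta) <= K%:R.
    by near: K; exact: nbhs_infty_ger.
  move: KD s0; move: (sin _ ^+ 2) => t + t0.
  rewrite ler_pdivrMr ?mulr_gt0// => KD.
  by rewrite mulrA ler_pdivrMr ?mulr_gt0//; apply: le_trans KD _; nra.
pose L (l : {ffun 'I_D -> 'I_K}) := `[< exists2 k, A k &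
  forall j : 'I_D, `|orbit_point theta beta k j - grid_point l j| < delta >].
have AL k : A k -> forall l : {ffun 'I_D -> 'I_K},
    (forall j : 'I_D, `|orbit_point theta beta k j - grid_point l j| < delta) ->
    L l.
  by move=> Ak l kl; apply/asboolP; exists k.
have QG : ((\sum_(l | L l) K%:R ^- D)%:E <= Q G)%E.
  (* The lower bound on [Q G] comes from its complement: a cell of side [1/K <= delta] in [L] keeps
     its points within [2 delta] of a good orbit point, hence in [G]. *)
  have := @probability_grid_le _ _ _ Q D K U K0 U_unif U_indep (~` G)
    (fun l => ~~ L l) (measurableC mG).
  rewrite probability_setC// => h.
  have {}h : (1 - Q G <= (\sum_(l : {ffun 'I_D -> 'I_K} | ~~ L l) K%:R ^- D)%:E)%E.
    apply: h => w l nGw lw; apply/negP => /asboolP[k Ak kl]; apply: nGw.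
    apply: (AG k w Ak) => j; have := kl j; have /andP[] := lw j.
    move: Kdelta; rewrite !ltr_norml => ? ? ? /andP[? ?].
    by apply/andP; split; lra.
  have QGfin : Q G \is a fin_num by rewrite fin_num_measure.
  rewrite -(fineK QGfin) lee_fin; move: h; rewrite -(fineK QGfin) lee_fin.
  by have := sum_grid_cst D K0; rewrite (bigID L)/=; lra.
have mean_le := mean_indic_le K0 delta_itv indep d0 AL.
near=> n.
have n0 : (0 < n)%N by near: n; exists 1%N.
apply: (le_trans (uniform_1_to_le n0 (N_unif n0) (mE n) (EA n n0))).
apply: (@le_trans _ _ ((\sum_(l | L l) K%:R ^- D)%:E +
    ((4 * D%:R + 3) * delta)%:E)%E); last by rewrite leeD2r.
rewrite lee_fin.
have Mn : M.+1%:R / n%:R <= delta.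
  rewrite ler_pdivrMr ?ltr0n// mulrC -ler_pdivrMr//.
  by near: n; exact: nbhs_infty_ger.
have D0 : 0 <= D%:R :> R by [].
have mn : mean (fun k => (A k)%:R) n <= \sum_(l | L l) K%:R ^- D +
    (D%:R * (2 * (delta + K%:R^-1)) +
     D%:R * (2 / (sin (pi * delta) ^+ 2 * K%:R))) + delta.
  by near: n.
have DK : D%:R * (2 * (delta + K%:R^-1)) <= D%:R * (4 * delta).
  by rewrite ler_wpM2l//; lra.
lra.
Unshelve. all: by end_near. Qed.

End limit_comparison.

(** * The affine form common to the orbit and the limit *)

Section excess_form.
Context {R : realType}.

Definition excess_form (m : nat) (u : nat -> R) : R :=
  u 0%N + 1 / m.+2%:R * \sum_(1 <= k < m.+1) u k.

(** Coordinate 0 contributes [delta], and the other [m] together [m / (m + 2)] times [delta]. *)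
Lemma excess_form_lipschitz (m : nat) (u v : nat -> R) (delta : R) :
  (forall j : 'I_m.+1, `|u j - v j| <= delta) ->
  `|excess_form m u - excess_form m v| <= 2 * delta.
Proof.
move=> uv; rewrite /excess_form opprD addrACA -mulrBr -sumrB.
apply: (le_trans (ler_normD _ _)).
rewrite (_ : 2 * delta = delta + delta); last by ring.
apply: lerD; first exact: (uv ord0).
rewrite normrM ger0_norm// mul1r mulrC ler_pdivrMr// big_add1 big_mkord.
have delta0 : 0 <= delta := le_trans (normr_ge0 _) (uv ord0).
apply: (le_trans (ler_norm_sum _ _ _)).
apply: (@le_trans _ _ (\sum_(r < m) delta)).
  by apply: ler_sum => r _; exact: (uv (lift ord0 r)).
by rewrite sumr_const card_ord -[_ *+ m]mulr_natr ler_wpM2l// ler_nat; lia.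
Qed.

(** The shifts by 1/2 add up to [1/2 + m / (2 (m + 2)) = (m + 1) / (m + 2)], the constant met in the
    quota computation. *)
Lemma limit_excessE (d' : measure_display) (T' : measurableType d')
    (Q : probability T' R) (U : nat -> {RV Q >-> R}) (m : nat) (gamma q : R) w :
  limit_excess m.+2 gamma q U w = excess_form m (fun k => U k w + 1 / 2) +
    (gamma * (q - 1 / m.+2%:R) - m.+1%:R / m.+2%:R).
Proof.
rewrite /limit_excess/= /limit_excess_fun /excess_form big_split/=.
rewrite sumr_const_nat subn1/= -[_ *+ m]mulr_natr -natr1 -natr1.
have m2 : m%:R + 1 + 1 != 0 :> R by rewrite !natr1.
by field.
Qed.

End excess_form.

(** The phases of the orbit: [x] comes from [frac (N p i + x)], the others from [N + gamma]. *)
Definition excess_shift (R : realType) (m : nat) (p : 'I_m.+2 -> R)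
    (gamma x : R) (i : 'I_m.+2) (r : nat) : R :=
  if r == 0%N then x else gamma * excess_freq p i r.

Lemma seat_excess_leE (R : realType) (m : nat) (p : 'I_m.+2 -> R) (gamma : R)
    (N : nat) (s : 'I_m.+2 -> int) (i : 'I_m.+2) (x : R) :
  \sum_j p j = 1 -> quota_allocation gamma p N s ->
  (forall j (z : int), j != i -> (N%:R + gamma) * (p j - p i) != z%:~R) ->
  ((s i)%:~R - N%:R * p i <= x) =
  (excess_form m (orbit_point (excess_freq p i) (excess_shift p gamma x i) N) +
   (gamma * (p i - 1 / m.+2%:R) - m.+1%:R / m.+2%:R) < x).
Proof.
move=> p1 quota_s regular; rewrite (quota_excess_le _ p1 quota_s regular).
rewrite -[RHS]ltrBrDr opprD opprK addrA; congr (_ + _ * _ < _).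
rewrite big_add1 big_mkord; apply: eq_bigr => r _.
by rewrite /orbit_point /excess_shift/= excess_freqS mulrDl.
Qed.

Theorem theorem3p13 (R : realType) (m : nat) (hm : (2 <= m)%N)
    (p : 'I_m -> R) (p_gt0 : forall i, 0 < p i)
    (p_sum : \sum_(i < m) p i = 1) (p_indep : Q_linearly_independent p)
    (gamma : R)
    (d : nat -> measure_display) (T : forall N0, measurableType (d N0))
    (P : forall N0, probability (T N0) R)
    (N : forall N0, {RV (P N0) >-> nat})
    (s : forall N0, 'I_m -> {RV (P N0) >-> int})
    (N_unif : forall N0, (0 < N0)%N -> uniform_1_to N0 (N N0))
    (s_quota : forall N0, (0 < N0)%N ->
      {ae P N0, forall w, 0 < (N N0 w)%:R + gamma ->
        quota_allocation gamma p (N N0 w) (fun i => s N0 i w)})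
    (d' : measure_display) (T' : measurableType d') (Q : probability T' R)
    (U : nat -> {RV Q >-> R})
    (U_unif : forall k, (k < m.-1)%N -> uniform_half (U k))
    (U_indep : mutually_independent [set k : nat | (k < m.-1)%N] U) :
  forall i : 'I_m,
    cvg_in_distribution (fun N0 => seat_excess (p i) (N N0) (s N0 i))
      (limit_excess m gamma (p i) U).
Proof.
(* From here on there are [m + 2] parties and [m + 1] uniform variables. *)
case: m hm p p_gt0 p_sum p_indep s s_quota U_unif U_indep => [|[|m]]// _ p _
  p_sum p_indep s s_quota U_unif U_indep i x Fcont.
set X := fun n => seat_excess (p i) (N n) (s n i).
set Y := limit_excess _ _ _ _ in Fcont *.
have mX n : measurable (X n @^-1` `]-oo, x]%classic).
  by rewrite -[_ @^-1` _]setTI; exact: measurable_funPT.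
have mY t : measurable (Y @^-1` `]-oo, t]%classic).
  by rewrite -[_ @^-1` _]setTI; exact: measurable_funPT.
have cdf_fin t : cdf Y t \is a fin_num by rewrite fin_num_measure.
have cdfX_fin n : cdf (X n) x \is a fin_num by rewrite fin_num_measure.
rewrite -(fineK (cdf_fin x)); apply: cvg_EFin; first exact: nearW.
apply/cvgrPdist_le => e e0.
have Fc : fine (cdf Y t) @[t --> x] --> fine (cdf Y x).
  by apply: fine_cvg; rewrite fineK//; exact: Fcont.
have e2 : 0 < e / 2 by rewrite divr_gt0.
have [eps /= eps0 Feps] : exists2 eps : R, 0 < eps &
    forall t, `|x - t| <= eps -> `|fine (cdf Y x) - fine (cdf Y t)| <= e / 2.
  have /cvgrPdist_le/(_ _ e2)/nbhs_ballP[eps /= eps0 ball_eps] := Fc.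
  exists (eps / 2); first by rewrite divr_gt0.
  by move=> t xt; apply: ball_eps; rewrite /ball/= (le_lt_trans xt)//; lra.
have c0 : 0 < 4 * m.+1%:R + 3 :> R by rewrite ltr_wpDl.
have [delta [delta_itv delta_eps delta_e]] : exists delta : R,
    [/\ 0 < delta <= 1 / 2, 4 * delta < eps &
        (4 * m.+1%:R + 3) * delta <= e / 2].
  (* [4 delta] is the Lipschitz constant 2 times the closeness [2 delta]; [eps / 8] keeps it
     strictly below [eps]. *)
  exists (Num.min (1 / 2) (Num.min (eps / 8) (e / 2 / (4 * m.+1%:R + 3)))).
  split.
  - by rewrite lt_min lt_min !divr_gt0//= ge_min lexx.
  - apply: (@le_lt_trans _ _ (4 * (eps / 8))); last by lra.
    by rewrite ler_pM2l// !ge_min lexx orbT.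
  - by rewrite mulrC -ler_pdivlMr// !ge_min lexx !orbT.
have [M _ regular] := near_quota_regular p_sum p_indep gamma i.
pose h k := excess_form m
  (orbit_point (excess_freq p i) (excess_shift p gamma x i) k) +
  (gamma * (p i - 1 / m.+2%:R) - m.+1%:R / m.+2%:R).
have X_le n : (0 < n)%N -> {ae P n, forall w, (M <= N n w)%N ->
    (X n w <= x) = (h (N n w) < x)}.
  move=> n0; apply: filterS (s_quota n n0) => w quota_w /regular[pos notint].
  exact: seat_excess_leE p_sum (quota_w pos) notint.
have Y_close k w : (forall j : 'I_m.+1, `|orbit_point (excess_freq p i)
      (excess_shift p gamma x i) k j - (U j w + 1 / 2)| < 2 * delta) ->
    `|h k - Y w| < eps.
  move=> close; rewrite /Y limit_excessE /h opprD addrACA subrr addr0.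
  apply: le_lt_trans delta_eps.
  rewrite (_ : 4 * delta = 2 * (2 * delta)); last by ring.
  by apply: excess_form_lipschitz => j; exact/ltW/close.
have indep := @excess_freq_indep R m p p_sum p_indep i.
(* The comparison is one-sided, so it is applied to the event [X n <= x] and to its complement, with
   the threshold for [Y] moved by [eps] either way. *)
have upper := @probability_limit_le R d T P N N_unif d' T' Q m.+1 U U_unif
  U_indep _ (excess_shift p gamma x i) indep delta
  (fun n => X n @^-1` `]-oo, x]%classic) (Y @^-1` `]-oo, x + eps]%classic)
  (fun k => h k < x) M delta_itv mX (mY _).
have lower := @probability_limit_le R d T P N N_unif d' T' Q m.+1 U U_unif
  U_indep _ (excess_shift p gamma x i) indep delta
  (fun n => ~` (X n @^-1` `]-oo, x]%classic))
  (~` (Y @^-1` `]-oo, x - eps]%classic))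
  (fun k => x <= h k) M delta_itv (fun n => measurableC (mX n))
  (measurableC (mY _)).
near=> n.
have n0 : (0 < n)%N by near: n; exists 1%N.
have up : (cdf (X n) x <= cdf Y (x + eps) + ((4 * m.+1%:R + 3) * delta)%:E)%E.
  near: n; apply: upper.
    move=> n n0; apply: filterS (X_le n n0) => w Xle MN /=.
    by rewrite in_itv/= Xle.
  move=> k w hk close; suff: Y w <= x + eps by rewrite /= in_itv.
  by have := Y_close k w close; rewrite ltr_norml => /andP[? ?]; lra.
have low : (1 - cdf (X n) x <=
    1 - cdf Y (x - eps) + ((4 * m.+1%:R + 3) * delta)%:E)%E.
  rewrite -!probability_setC//; near: n; apply: lower.
    move=> n n0; apply: filterS (X_le n n0) => w Xle MN /=.
    by rewrite in_itv/= Xle// => /negP; rewrite -leNgt.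
  move=> k w hk close; suff: x - eps < Y w.
    by move=> Yw; rewrite /= in_itv/= => /(lt_le_trans Yw); rewrite ltxx.
  by have := Y_close k w close; rewrite ltr_norml => /andP[? ?]; lra.
move: up low.
rewrite -(fineK (cdfX_fin n)) -(fineK (cdf_fin (x + eps))).
rewrite -(fineK (cdf_fin (x - eps))) -!EFinB -!EFinD !lee_fin/=.
have := Feps (x + eps); have := Feps (x - eps).
rewrite !opprD !opprK !addrA !subrr !add0r normrN ger0_norm ?(ltW eps0)//.
move=> /(_ (lexx _)) + /(_ (lexx _)).
rewrite !ler_norml => /andP[? ?] /andP[? ?] up low.
by apply/andP; split; lra.
Unshelve. all: by end_near. Qed.
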